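(* Let $G$ be a connected graph with maximum degree $\Delta$. Then $\mathrm{vp}^-(G) \geq \left\lceil \frac{\Delta+1}{3} \right\rceil$. If moreover $G$ is bipartite, then $\mathrm{vp}^-(G) \geq \left\lceil \frac{\Delta}{2} \right\rceil$.
   Context: All graphs are finite, undirected and simple. A $u,v$-geodesic is a shortest $u,v$-path. For a vertex $x$ of $G$, a set $S \subseteq V(G)$ is an $x$-position set if for every $y \in S$ no vertex of $S \setminus \{y\}$ lies on any $x,y$-geodesic in $G$. The $x$-position number $p_x(G)$ is the maximum cardinality of an $x$-position set of $G$. The minimum vertex position number is $\mathrm{vp}^-(G) = \min_{x \in V(G)} p_x(G)$. *)

(* Defs.v *)
From mathcomp Require Import all_boot.
From mathcomp Require Import boolp.

Set Implicit Arguments.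
Unset Strict Implicit.
Unset Printing Implicit Defensive.

Record sgraph := SGraph {
  vertex :> finType;
  adj : rel vertex;
  adj_sym : symmetric adj;
  adj_irrefl : irreflexive adj
}.

Section VertexPosition.
Variable G : sgraph.
Implicit Types (u v x y z : G) (p : seq G) (S : {set G}).

Definition degree v : nat := #|[set w : G | adj v w]|.

Definition max_degree : nat := \max_(v : G) degree v.

(* The null graph is not connected. *)
Definition connected : Prop :=
  0 < #|G| /\ forall u v, connect (@adj G) u v.

(* A and its complement are the two (possibly empty) colour classes. *)
Definition bipartite : Prop :=
  exists A : {set G}, forall u v, adj u v -> (u \in A) != (v \in A).

(* The vertex sequence of the path is u :: p, so size p is its length. *)
Definition is_path u v p : Prop :=
  [/\ path (@adj G) u p, last u p = v & uniq (u :: p)].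

Definition geodesic u v p : Prop :=
  is_path u v p /\ forall q : seq G, is_path u v q -> size p <= size q.

Definition position_set x S : Prop :=
  forall y, y \in S -> forall z, z \in S :\ y ->
  forall p, geodesic x y p -> z \notin x :: p.

Definition position_number x : nat :=
  \max_(S : {set G} | `[< position_set x S >]) #|S|.

(* Every position number is at most #|G|, so the neutral value #|G| does not
   affect the minimum over the vertices of a graph with at least one vertex. *)
Definition vp_minus : nat :=
  \big[minn/#|G|]_(x : G) position_number x.

End VertexPosition.

(* Main.v *)
Require Import Defs.
From mathcomp Require Import all_boot all_order all_algebra.
From mathcomp Require Import boolp zify.

Set Implicit Arguments.
Unset Strict Implicit.
Unset Printing Implicit Defensive.

(** Fix a root x and a vertex v of maximum degree. Vertices at the same distance
    from x form an x-position set, since a geodesic from x meets each distance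
    level at most once. The closed neighbourhood of v has Delta + 1 vertices and
    meets only the levels d(x,v) - 1, d(x,v), d(x,v) + 1, so one level contains
    a third of it. In a bipartite graph the Delta neighbours of v avoid the
    middle level, as adjacent vertices have distances of different parity. *)

(** Distance as least walk length. Walks, unlike the simple paths of [geodesic], can be extended by
    an edge with no check for repeated vertices. *)
Definition is_distance (G : sgraph) (x : G) (d : G -> nat) : Prop :=
  (forall p, path (@adj G) x p -> d (last x p) <= size p) /\
  (forall y, exists p, [/\ path (@adj G) x p, last x p = y & size p = d y]).

Lemma distance_exists (G : sgraph) (x : G) :
  connected G -> exists d, is_distance x d.
Proof.
move=> [_ conn].
pose walk y n := `[< exists p, [/\ path (@adj G) x p, last x p = y & size p = n] >].
have walk_ex y : exists n, walk y n.
  by have /connectP[p xp ->] := conn x y; exists (size p); apply/asboolP; exists p.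
exists (fun y => ex_minn (walk_ex y)); split=> [p xp | y].
  by case: ex_minnP => m _; apply; apply/asboolP; exists p.
by case: ex_minnP => m /asboolP.
Qed.

Section Distance.
Variables (G : sgraph) (x : G) (d : G -> nat).
Hypothesis dP : is_distance x d.

Lemma distance_adj u v : adj u v -> d v <= (d u).+1.
Proof.
move=> uv; have [p [xp pu <-]] := dP.2 u.
have := dP.1 (rcons p v); rewrite last_rcons size_rcons; apply.
by rewrite rcons_path xp pu.
Qed.

(** A shortest walk from [x] to [y] can be shortened to a simple path, and a geodesic is no longer
    than that. *)
Lemma size_geodesic y p : geodesic x y p -> size p = d y.
Proof.
move=> [[xp <- _] p_min]; apply/eqP; rewrite eqn_leq dP.1 // andbT.
have [q [xq qE <-]] := dP.2 (last x p).
move: qE; case/shortenP: xq => r xr uniq_r sub_rq rE.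
apply: leq_trans (p_min r _) _; first by split.
by apply: uniq_leq_size sub_rq; case/andP: uniq_r.
Qed.

Lemma level_position_set (S : {set G}) k :
  (forall y, y \in S -> d y = k) -> position_set x S.
Proof.
move=> Sk y yS z; rewrite in_setD1 => /andP[zNy zS] p geo.
have szp := size_geodesic geo; have [[xp py _] _] := geo.
apply/negP => zp.
case/splitPl: zp xp py szp => p1 p2 p1z.
rewrite cat_path last_cat size_cat p1z => /andP[xp1 _].
(* The part [p1] up to [z] already has length at least [k], the length of all of [p]. Hence [p2] is
   empty and [z = y]. *)
have := dP.1 _ xp1; rewrite p1z (Sk z zS) (Sk y yS).
case: p2 => [|w p2] /=; last by lia.
by move=> _ zy; rewrite zy eqxx in zNy.
Qed.

Lemma card_level (S : {set G}) k :
  #|[set y in S | d y == k]| <= position_number x.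
Proof.
apply: (@leq_bigmax_cond _ _ (fun S : {set G} => #|S|)).
by apply/asboolP/(@level_position_set _ k) => y; rewrite inE => /andP[_ /eqP].
Qed.

(** Each edge of a walk from [x] switches the colour class, so the parity of the length tells
    whether the ends have different colours. *)
Lemma distance_parity (A : {set G}) y :
  (forall u v, adj u v -> (u \in A) != (v \in A)) ->
  odd (d y) = (x \in A) (+) (y \in A).
Proof.
move=> bipA; have [p [xp <- <-]] := dP.2 y.
elim: p x xp {y} => [|u p IHp] z /=; first by rewrite addbb.
case/andP=> /bipA zu /IHp ->.
by move: zu; case: (z \in A); case: (u \in A); case: (_ \in A).
Qed.

Lemma closed_degree_le (v : G) : degree v + 1 <= 3 * position_number x.
Proof.
set N := v |: [set w | adj v w].
have cardN : #|N| = degree v + 1.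
  by rewrite cardsU1 inE adj_irrefl addnC.
pose L k := [set y in N | d y == k].
(* For [d v = 0] the first two levels coincide; the union bound below does not require disjoint
   levels. *)
have cover : N \subset (L (d v).-1 :|: L (d v)) :|: L (d v).+1.
  apply/subsetP => w wN.
  have in_L k : (w \in L k) = (d w == k) by rewrite in_set wN.
  rewrite !in_setU !in_L.
  move: wN; rewrite !inE => /orP[/eqP->|vw]; first by rewrite eqxx orbT.
  have := distance_adj vw; rewrite adj_sym in vw.
  have := distance_adj vw; lia.
have := subset_leq_card cover; rewrite cardN.
have := card_level N (d v).-1; have := card_level N (d v).
have := card_level N (d v).+1; rewrite -!/(L _).
have := leq_card_setU (L (d v).-1 :|: L (d v)) (L (d v).+1).
have := leq_card_setU (L (d v).-1) (L (d v)).
by move=> [+ _] [+ _]; lia.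
Qed.

Lemma bipartite_degree_le (v : G) : bipartite G -> degree v <= 2 * position_number x.
Proof.
move=> [A bipA]; set N := [set w | adj v w].
pose L k := [set y in N | d y == k].
have cover : N \subset L (d v).-1 :|: L (d v).+1.
  apply/subsetP => w wN.
  have in_L k : (w \in L k) = (d w == k) by rewrite in_set wN.
  rewrite in_setU !in_L; move: wN; rewrite inE => vw.
  (* This rules out [d w = d v], also when [d v = 0] and [(d v).-1] is the level of [v] itself. *)
  have : odd (d w) != odd (d v).
    rewrite !(distance_parity _ bipA) //; have := bipA _ _ vw.
    by case: (x \in A); case: (v \in A); case: (w \in A).
  have := distance_adj vw; rewrite adj_sym in vw.
  have := distance_adj vw; lia.
have := subset_leq_card cover; rewrite -/(degree v).
have := card_level N (d v).-1; have := card_level N (d v).+1.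
have := leq_card_setU (L (d v).-1) (L (d v).+1); rewrite -!/(L _).
by move=> [+ _]; rewrite /degree -/N; lia.
Qed.

End Distance.

Lemma leq_mul_vp_minus (G : sgraph) m c : 0 < #|G| ->
  (forall x : G, m <= c * position_number x) -> m <= c * vp_minus G.
Proof.
move=> /card_gt0P[x0 _] m_le; apply: (big_ind (fun n => m <= c * n)) => //.
  (* The neutral value [#|G|] of the minimum meets the bound too, because [position_number x0] is at
     most [#|G|]. *)
  apply: leq_trans (m_le x0) _; rewrite leq_mul2l; apply/orP; right.
  by apply/bigmax_leqP => S _; exact: max_card.
by move=> a b; rewrite /minn; case: ifP.
Qed.

Lemma max_degree_attained (G : sgraph) :
  0 < #|G| -> exists v : G, max_degree G = degree v.
Proof. by move=> /(eq_bigmax (@degree G))[v ?]; exists v. Qed.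

Local Open Scope ring_scope.

(** A ceiling is at most an integer exactly when its argument is, so the counting bounds in [nat]
    suffice. *)
Lemma ceil_ratio_le (m n c : nat) : (0 < c)%N -> (m <= c * n)%N ->
  Num.ceil (m%:R / c%:R : rat) <= n%:Z.
Proof.
move=> c0 mcn; rewrite Num.Theory.ceil_le_int Num.Theory.ler_pdivrMr ?Num.Theory.ltr0n //.
by rewrite -pmulrn -GRing.natrM Num.Theory.ler_nat mulnC.
Qed.

Theorem theorem2p9 (G : sgraph) (G_connected : connected G) :
  Num.ceil (((max_degree G)%:R + 1) / 3%:R : rat) <= (vp_minus G)%:Z
  /\ (bipartite G ->
      Num.ceil ((max_degree G)%:R / 2%:R : rat) <= (vp_minus G)%:Z).
Proof.
have G_gt0 := G_connected.1; have [v ->] := max_degree_attained G_gt0.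
split=> [|bipG].
  rewrite -(GRing.natrD _ _ 1); apply: ceil_ratio_le => //.
  apply: leq_mul_vp_minus => // x.
  by have [d dP] := distance_exists x G_connected; exact: (closed_degree_le dP _).
apply: ceil_ratio_le => //; apply: leq_mul_vp_minus => // x.
by have [d dP] := distance_exists x G_connected; exact: (bipartite_degree_le dP _).
Qed.
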